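(* Let $(a,y,b) \in \mathbb{N}_0^3$ be such that $N := \mathrm{lcm}(a,y,b) \neq 0$, and put $n := \mathrm{lcm}(y,b)$, $m := \mathrm{lcm}(y,a)$, $K := \gcd(a,y,b)$. Then: (1) For all $(x,z) \in \mathbb{N}_0^2$, the number $x \bullet_{a,y,b} z = L(x,a,y,b,z)$ is a divisor of $N$ and a multiple of $K$. In particular, $x \bullet_{a,y,b} z$ takes only a finite number of values. (2) The product $\bullet_{a,y,b}$ is $(n,m)$-periodic: for all $x,x',z,z'\in\mathbb{N}_0$, $$x \equiv x' \ (\mathrm{mod}\ n) \ \Rightarrow\ x \bullet_{a,y,b} z = x' \bullet_{a,y,b} z, \qquad z \equiv z' \ (\mathrm{mod}\ m) \ \Rightarrow\ x \bullet_{a,y,b} z = x \bullet_{a,y,b} z'.$$ It follows that $\bullet_{a,y,b}$ passes to the quotient, defining a product on $\mathbb{Z}/N\mathbb{Z}$, or even on $K\mathbb{Z}/N\mathbb{Z}$. (3) Let $[1,KN]$ be the set of divisors of $KN$ and, for $x\in[1,KN]$, $x' := \frac{KN}{x}$. The conjugation map $$\gamma : [1,KN] \to [1,KN], \quad x \mapsto x' = \frac{KN}{x}$$ is an isomorphism from the semigroup $[1,KN]$ with product $\bullet_{a,y,b}$ onto the semigroup $[1,KN]$ with the conjugate product $\bullet_{b',y',a'}$. By restriction, the same holds for the subsemigroup $[K,N] = \{ d \mid K \text{ divides } d,\ d \text{ divides } N \}$.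
   Context: $\mathbb{N}_0=\{0,1,2,\dots\}$ is regarded as a lattice with $\land = \mathrm{lcm}$ and $\lor = \gcd$ (with $\gcd(0,n)=n$, $\mathrm{lcm}(0,n)=0$). For $x,a,y,b,z\in\mathbb{N}_0$, $$x\bullet_{a,y,b} z := L(x,a,y,b,z) := \bigl(b \land (z \lor (a \land y))\bigr) \lor \bigl(z \land (b \lor (x \land y))\bigr) \lor \bigl(x \land (a \lor (z \land y))\bigr) \lor \bigl(a \land (x \lor (b \land y))\bigr).$$ This binary operation is associative for every $(a,y,b)$. ''Passes to the quotient'' means that the class modulo $N$ of $x\bullet_{a,y,b}z$ depends only on the classes modulo $N$ of $x,z\in\mathbb{N}_0$, where $\mathbb{Z}/N\mathbb{Z}$ is viewed as the set of classes modulo $N$ of elements of $\mathbb{N}_0$, and the subset $K\mathbb{Z}/N\mathbb{Z}$ is stable under the induced product. *)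

(* Defs.v *)
From mathcomp Require Import all_boot all_algebra.

Set Implicit Arguments.
Unset Strict Implicit.
Unset Printing Implicit Defensive.

(* The lattice on nat is the one with meet lcm and join gcd, i.e. the dual of
   divisibility: in [L] every [lcmn] is a meet and every [gcdn] a join. *)
Definition L (x a y b z : nat) : nat :=
  gcdn (gcdn (gcdn (lcmn b (gcdn z (lcmn a y)))
                   (lcmn z (gcdn b (lcmn x y))))
             (lcmn x (gcdn a (lcmn z y))))
       (lcmn a (gcdn x (lcmn b y))).

Definition bullet (a y b : nat) : nat -> nat -> nat := fun x z => L x a y b z.

Section Quotient.

(* Meant for N > 0, where N.-1.+1 = N; unlike 'Z_N this is also correct when
   N = 1. *)
Definition Zmod (N : nat) : Type := 'I_N.-1.+1.

Definition class_mod (N x : nat) : Zmod N := inZp x.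

(* The subset KZ/NZ; for N > 0 every class has representatives in nat, so
   natural multiples of K suffice. *)
Definition multiples_mod (K N : nat) (u : Zmod N) : Prop :=
  exists k : nat, u = class_mod N (K * k).

Definition passes_to_quotient (N : nat) (op : nat -> nat -> nat) : Prop :=
  forall x x' z z' : nat,
    x = x' %[mod N] -> z = z' %[mod N] -> op x z = op x' z' %[mod N].

Definition induces_on_quotient (N : nat) (op : nat -> nat -> nat)
    (opN : Zmod N -> Zmod N -> Zmod N) : Prop :=
  forall x z : nat, opN (class_mod N x) (class_mod N z) = class_mod N (op x z).

End Quotient.

Section Semigroups.

Variable T : Type.

Definition is_semigroup (S : {pred T}) (op : T -> T -> T) : Prop :=
  {in S &, forall x z, op x z \in S} /\
  {in S & &, forall x z w, op x (op z w) = op (op x z) w}.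

Definition semigroup_iso (S1 : {pred T}) (op1 : T -> T -> T)
    (S2 : {pred T}) (op2 : T -> T -> T) (f : T -> T) : Prop :=
  [/\ {in S1, forall x, f x \in S2},
      {in S1 &, injective f},
      {in S2, forall u, exists2 x, x \in S1 & f x = u}
    & {in S1 &, {morph f : x z / op1 x z >-> op2 x z}}].

End Semigroups.

(* The interval [K, N] for divisibility; [1, M] is the set of divisors of M. *)
Definition dvd_interval (K N : nat) : {pred nat} :=
  [pred d | (K %| d) && (d %| N)].

(* On divisors x of M the quotient M %/ x is exact. *)
Definition conjugation (M x : nat) : nat := M %/ x.

(* Main.v *)
Require Import Defs.
From mathcomp Require Import all_boot all_algebra.

(** A natural number is determined by the prime powers dividing it, and for a
    prime power q the predicate "q divides _" turns [gcdn] into [&&] and [lcmn]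
    into [||]. Hence every identity or inequality between gcd-lcm expressions
    reduces to a check over the booleans: this gives associativity, the bounds
    by K and N, and L x a y b z = L (gcdn x n) a y b z, which implies
    periodicity. Conjugation exchanges gcd and lcm, and the dual of L is L with
    a and b exchanged. *)

Set Implicit Arguments.
Unset Strict Implicit.
Unset Printing Implicit Defensive.

(** The [p]-adic valuation of an lcm is the maximum of the two valuations. Zero is treated apart,
    because [logn p 0] is 0 although every power divides 0. *)
Lemma pfactor_dvdn_lcm p k u v : prime p ->
  (p ^ k %| lcmn u v) = (p ^ k %| u) || (p ^ k %| v).
Proof.
move=> pr_p; have [->|u_gt0] := posnP u; first by rewrite lcm0n !dvdn0.
have [->|v_gt0] := posnP v; first by rewrite lcmn0 !dvdn0 orbT.
by rewrite !pfactor_dvdn ?lcmn_gt0 ?u_gt0 // logn_lcm // leq_max.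
Qed.

Lemma dvdn_pfactorP u v :
  (forall p k, prime p -> p ^ k %| u -> p ^ k %| v) -> u %| v.
Proof.
move=> uv; have [u0|u_gt0] := posnP u.
  have [->|v_gt0] := posnP v; first exact: dvdn0.
  (* All prime powers divide [u = 0], hence [v]; the power [2 ^ v] is already too large for a
     positive [v]. *)
  have: 2 ^ v %| v by apply: uv; rewrite // u0 dvdn0.
  by move/(dvdn_leq v_gt0); rewrite leqNgt ltn_expl.
apply/dvdn_partP=> // p; rewrite mem_primes => /andP[pr_p _].
by rewrite p_part; apply: uv => //; apply: pfactor_dvdnn.
Qed.

Lemma eqn_pfactor u v :
  (forall p k, prime p -> (p ^ k %| u) = (p ^ k %| v)) -> u = v.
Proof.
by move=> uv; apply/eqP; rewrite eqn_dvd; apply/andP; split;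
  apply: dvdn_pfactorP => p k pr_p; rewrite uv.
Qed.

Lemma bullet_assoc a y b : associative (bullet a y b).
Proof.
move=> x z w; apply: eqn_pfactor => p k pr_p.
rewrite /bullet /L !(dvdn_gcd, pfactor_dvdn_lcm _ _ _ pr_p).
by case: (_ %| a); case: (_ %| y); case: (_ %| b);
  case: (_ %| x); case: (_ %| z); case: (_ %| w).
Qed.

Lemma bullet_dvd_lcm a y b x z : bullet a y b x z %| lcmn (lcmn a y) b.
Proof.
apply: dvdn_pfactorP => p k pr_p.
rewrite /bullet /L !(dvdn_gcd, pfactor_dvdn_lcm _ _ _ pr_p).
by case: (_ %| a); case: (_ %| y); case: (_ %| b);
  case: (_ %| x); case: (_ %| z).
Qed.

Lemma gcd_dvd_bullet a y b x z : gcdn (gcdn a y) b %| bullet a y b x z.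
Proof.
apply: dvdn_pfactorP => p k pr_p.
rewrite /bullet /L !(dvdn_gcd, pfactor_dvdn_lcm _ _ _ pr_p).
by case: (_ %| a); case: (_ %| y); case: (_ %| b);
  case: (_ %| x); case: (_ %| z).
Qed.

(** This symmetry turns the left period [lcmn y b] into the right period [lcmn y a]. *)
Lemma bullet_sym a y b x z : bullet a y b x z = bullet b y a z x.
Proof.
apply: eqn_pfactor => p k pr_p.
rewrite /bullet /L !(dvdn_gcd, pfactor_dvdn_lcm _ _ _ pr_p).
by case: (_ %| a); case: (_ %| y); case: (_ %| b);
  case: (_ %| x); case: (_ %| z).
Qed.

(** Only prime powers dividing neither [y] nor [b] could see a change of [x]; for these the boolean
    form of [L] collapses to the conjunction of the values at [a] and [z]. *)
Lemma bullet_gcdl a y b x z :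
  bullet a y b (gcdn x (lcmn y b)) z = bullet a y b x z.
Proof.
apply: eqn_pfactor => p k pr_p.
rewrite /bullet /L !(dvdn_gcd, pfactor_dvdn_lcm _ _ _ pr_p).
by case: (_ %| a); case: (_ %| y); case: (_ %| b);
  case: (_ %| x); case: (_ %| z).
Qed.

Lemma bullet_periodl a y b x x' z :
  x = x' %[mod lcmn y b] -> bullet a y b x z = bullet a y b x' z.
Proof.
(* The gcd of [x] with the period depends only on the residue of [x]. *)
move=> xx'; rewrite -(bullet_gcdl a y b x) -(bullet_gcdl a y b x').
by rewrite -[gcdn x _]gcdn_modl xx' gcdn_modl.
Qed.

Lemma bullet_periodr a y b x z z' :
  z = z' %[mod lcmn y a] -> bullet a y b x z = bullet a y b x z'.
Proof. by move=> zz'; rewrite !(bullet_sym a); apply: bullet_periodl. Qed.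

Lemma eqn_mod_dvd_modulus d N x x' :
  d %| N -> x = x' %[mod N] -> x = x' %[mod d].
Proof. by move=> dN xx'; rewrite -(modn_dvdm x dN) xx' modn_dvdm. Qed.

(** Both periods divide [N], so the values agree exactly and not merely modulo [N]. *)
Lemma bullet_mod a y b x x' z z' (N := lcmn (lcmn a y) b) :
  x = x' %[mod N] -> z = z' %[mod N] -> bullet a y b x z = bullet a y b x' z'.
Proof.
move=> xx' zz'; rewrite (@bullet_periodl a y b x x'); last first.
  by apply: eqn_mod_dvd_modulus xx'; rewrite /N -lcmnA dvdn_lcmr.
apply: bullet_periodr; apply: eqn_mod_dvd_modulus zz'.
by rewrite /N [lcmn a y]lcmnC dvdn_lcml.
Qed.

Section Conjugation.

Variable M : nat.
Hypothesis M_gt0 : 0 < M.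

Local Notation gamma := (conjugation M).

Lemma conjugation_dvd u : u %| M -> gamma u %| M.
Proof. exact: dvdn_div. Qed.

Lemma conjugationK u : u %| M -> gamma (gamma u) = u.
Proof. by move=> uM; rewrite /conjugation divnA // mulKn. Qed.

(** Both divisibilities follow from the adjunction: for [e %| M], [t %| M %/ e] if and only if
    [t * e %| M]. *)
Lemma conjugation_lcm u v : u %| M -> v %| M ->
  gamma (lcmn u v) = gcdn (gamma u) (gamma v).
Proof.
move=> uM vM; have lM : lcmn u v %| M by rewrite dvdn_lcm uM.
apply/eqP; rewrite eqn_dvd; apply/andP; split; last first.
  rewrite dvdn_divRL // muln_lcmr dvdn_lcm -!dvdn_divRL //.
  by rewrite dvdn_gcdl dvdn_gcdr.
rewrite dvdn_gcd !dvdn_divRL // /conjugation.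
by apply/andP; split; rewrite -[X in _ %| X](divnK lM) dvdn_mul //
  (dvdn_lcml, dvdn_lcmr).
Qed.

Lemma conjugation_gcd u v : u %| M -> v %| M ->
  gamma (gcdn u v) = lcmn (gamma u) (gamma v).
Proof.
move=> uM vM; rewrite -{1}(conjugationK uM) -{1}(conjugationK vM).
have [uM' vM'] := (conjugation_dvd uM, conjugation_dvd vM).
by rewrite -conjugation_lcm // conjugationK // dvdn_lcm uM'.
Qed.

Lemma conjugation_bullet a y b x z :
    a %| M -> y %| M -> b %| M -> x %| M -> z %| M ->
  gamma (bullet a y b x z)
    = bullet (gamma b) (gamma y) (gamma a) (gamma x) (gamma z).
Proof.
move=> aM yM bM xM zM.
have gM u v : u %| M -> gcdn u v %| M by apply/dvdn_trans/dvdn_gcdl.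
have lM u v : u %| M -> v %| M -> lcmn u v %| M by rewrite dvdn_lcm => -> ->.
rewrite {1}/bullet /L !(conjugation_gcd, conjugation_lcm) ?(gM, lM) //.
(* The left side is now the dual polynomial of [L] in the conjugates. Self-duality up to exchanging
   [a] and [b] is checked with the divisibilities of the conjugates as boolean variables. *)
apply: eqn_pfactor => p k pr_p.
rewrite /bullet /L !(dvdn_gcd, pfactor_dvdn_lcm _ _ _ pr_p).
by case: (_ %| _ a); case: (_ %| _ y); case: (_ %| _ b);
  case: (_ %| _ x); case: (_ %| _ z).
Qed.

Section Interval.

(* Both (c, d) = (1, K * N) and (c, d) = (K, N) have product M = K * N. *)
Variables c d : nat.
Hypothesis cdM : c * d = M.

Lemma dvd_interval_dvd u : u \in dvd_interval c d -> u %| M.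
Proof. by case/andP=> _ ud; rewrite -cdM dvdn_mull. Qed.

(** The two bounds trade places: since [c * d = M], [u %| d] gives [c %| M %/ u], and [c %| u] gives
    [M %/ u %| d]. *)
Lemma conjugation_interval u :
  u \in dvd_interval c d -> gamma u \in dvd_interval c d.
Proof.
move=> ucd; have uM := dvd_interval_dvd ucd; case/andP: ucd => cu ud.
have u_gt0 := dvdn_gt0 M_gt0 uM.
rewrite inE dvdn_divRL // -{1}cdM dvdn_mul //=.
by rewrite -(@dvdn_pmul2r u) // divnK // -cdM mulnC dvdn_mul.
Qed.

Variables a y b : nat.
Hypotheses (c_dvd : c %| gcdn (gcdn a y) b) (dvd_d : lcmn (lcmn a y) b %| d).

Lemma bullet_interval x z : bullet a y b x z \in dvd_interval c d.
Proof.
by rewrite inE (dvdn_trans c_dvd) ?gcd_dvd_bullet //=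
  (dvdn_trans _ dvd_d) ?bullet_dvd_lcm.
Qed.

Lemma bullet_semigroup : is_semigroup (dvd_interval c d) (bullet a y b).
Proof.
by split=> [x z _ _|x z w _ _ _]; [apply: bullet_interval|apply: bullet_assoc].
Qed.

Lemma conjugation_iso :
  semigroup_iso (dvd_interval c d) (bullet a y b)
    (dvd_interval c d) (bullet (gamma b) (gamma y) (gamma a)) gamma.
Proof.
have: lcmn (lcmn a y) b %| M by rewrite (dvdn_trans dvd_d) // -cdM dvdn_mull.
rewrite !dvdn_lcm => /andP[/andP[aM yM] bM].
split=> [|x z /dvd_interval_dvd xM /dvd_interval_dvd zM eq_xz|u ucd|x z].
- exact: conjugation_interval.
- by rewrite -(conjugationK xM) eq_xz conjugationK.
- exists (gamma u); first exact: conjugation_interval.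
  by rewrite conjugationK // dvd_interval_dvd.
by move=> /dvd_interval_dvd xM /dvd_interval_dvd zM; apply: conjugation_bullet.
Qed.

(** Closure is transported from [bullet a y b] through the surjective morphism [gamma]. *)
Lemma conjugate_bullet_semigroup :
  is_semigroup (dvd_interval c d) (bullet (gamma b) (gamma y) (gamma a)).
Proof.
have [_ _ onto morph] := conjugation_iso.
split=> [_ _ /onto[x xcd <-] /onto[z zcd <-]|x z w _ _ _].
  by rewrite -morph //; apply/conjugation_interval/bullet_interval.
exact: bullet_assoc.
Qed.

End Interval.

End Conjugation.

Theorem theorem6p4 (a y b : nat) :
  let N := lcmn (lcmn a y) b in
  let n := lcmn y b in
  let m := lcmn y a in
  let K := gcdn (gcdn a y) b in
  let gamma := conjugation (K * N) in
  N <> 0 ->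
  [/\
    (* (1) *)
    (forall x z : nat, bullet a y b x z %| N /\ K %| bullet a y b x z) /\
    (exists s : seq nat, forall x z : nat, bullet a y b x z \in s),

    (* (2) *)
    [/\ forall x x' z : nat,
          x = x' %[mod n] -> bullet a y b x z = bullet a y b x' z,
        forall x z z' : nat,
          z = z' %[mod m] -> bullet a y b x z = bullet a y b x z',
        passes_to_quotient N (bullet a y b)
      & exists opN : Zmod N -> Zmod N -> Zmod N,
          induces_on_quotient (bullet a y b) opN /\
          (forall u v : Zmod N, multiples_mod K u -> multiples_mod K v ->
             multiples_mod K (opN u v))]

    (* (3) *)
  & [/\ is_semigroup (dvd_interval 1 (K * N)) (bullet a y b),
        is_semigroup (dvd_interval 1 (K * N))
          (bullet (gamma b) (gamma y) (gamma a)),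
        semigroup_iso (dvd_interval 1 (K * N)) (bullet a y b)
          (dvd_interval 1 (K * N)) (bullet (gamma b) (gamma y) (gamma a)) gamma
      & [/\ {subset dvd_interval K N <= dvd_interval 1 (K * N)},
            is_semigroup (dvd_interval K N) (bullet a y b),
            is_semigroup (dvd_interval K N)
              (bullet (gamma b) (gamma y) (gamma a))
          & semigroup_iso (dvd_interval K N) (bullet a y b)
              (dvd_interval K N) (bullet (gamma b) (gamma y) (gamma a))
              gamma]]].
Proof.
move=> N n m K gamma /eqP; rewrite -lt0n => N_gt0.
have K_gt0 : 0 < K.
  move: N_gt0; rewrite !lcmn_gt0 => /andP[/andP[a_gt0 _] _].
  by rewrite !gcdn_gt0 a_gt0.
have KN_gt0 : 0 < K * N by rewrite muln_gt0 K_gt0.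
(* This equation and the next divisibility are the interval hypotheses for [c = 1] and
   [d = K * N]. *)
have prod1 : 1 * (K * N) = K * N by rewrite mul1n.
have dvdN : N %| K * N by rewrite dvdn_mull.
split.
- split=> [x z|]; first by rewrite bullet_dvd_lcm gcd_dvd_bullet.
  by exists (divisors N) => x z; rewrite -dvdn_divisors // bullet_dvd_lcm.
- split=> [x x' z|x z z'|x x' z z' xx' zz'|].
  + exact: bullet_periodl.
  + exact: bullet_periodr.
  + by rewrite (bullet_mod xx' zz').
  (* Classes are multiplied through their representatives below [N], the coercion of ordinals to
     [nat]. *)
  exists (fun u v => class_mod N (bullet a y b u v)); split=> [x z|u v _ _].
    by congr (class_mod N _); apply: bullet_mod; rewrite /= prednK // modn_mod.
  (* The product of the representatives is itself a multiple of [K]. *)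
  exists (bullet a y b u v %/ K).
  by rewrite mulnC divnK // gcd_dvd_bullet.
split; [exact: bullet_semigroup|exact: conjugate_bullet_semigroup|
  exact: conjugation_iso|].
split; [|exact: bullet_semigroup|exact: conjugate_bullet_semigroup|
  exact: conjugation_iso].
by move=> u /andP[_ uN]; rewrite inE dvd1n (dvdn_trans uN).
Qed.
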